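(* Let $f:\Omega\subseteq\mathbb{R}^d\to\mathbb{R}$ and a probability density $\pi$ on $\mathbb{R}^d$ satisfy: $f$ is continuous with finite global minimum value $f^*=0$, i.e. $f(x)\geq 0$ for all $x\in\Omega$; the set of global minima $\Omega^*=\{x\in\Omega: f(x)=f^*\}$ is non-empty; $\pi(x)>0$ for every $x\in\mathbb{R}^d$ and $\int_{\mathbb{R}^d}\pi(x)\,dx=1$. For measurable $S\subseteq\mathbb{R}^d$ write $\Pi(S)=\int_S\pi(x)\,dx$. The nascent minima distribution density $m_k$ associated with $f$ and $\pi$ satisfies: (1) For all $k\geq 0$, $m_k$ is a probability density function on $\Omega$; in particular, for $k=0$, $m_0(x)=\pi(x)/\Pi(\Omega)$. (2) If $\nabla\pi$ and $\nabla f:\mathbb{R}^d\to\mathbb{R}^d$ are continuous real functions in each dimension (component), then $$\nabla\log m_k(x)=-k\,\nabla f(x)+\frac{\nabla\pi(x)}{\pi(x)}.$$ (3) For every $k\geq 0$, $$\frac{d}{dk}\log m_k(x)=\mathbb{E}_{m_k}(f)-f(x),\qquad\text{where }\mathbb{E}_{m_k}(f)=\int_\Omega f(x)\,m_k(x)\,dx.$$ (4) For any $x\in\Omega$, as $k\to\infty$: (a) if $\Pi(\Omega^* )=0$, then $\lim_{k\to\infty}m_k(x)=0$ for $x\notin\Omega^*$ and $\lim_{k\to\infty}m_k(x)=\infty$ for $x\in\Omega^*$; (b) if $\Pi(\Omega^* )>0$, then $\lim_{k\to\infty}m_k(x)=0$ for $x\notin\Omega^*$ and $\lim_{k\to\infty}m_k(x)=\dfrac{\pi(x)}{\Pi(\Omega^*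 )}$ for $x\in\Omega^*$. (5) For $k>0$ let $\Omega_k$ be the set of maximizers of $m_k(x)$ over $x\in\Omega$. If $\pi$ is bounded, then any sequence of $x_k^*\in\Omega_k$, $k>0$, satisfies: (a) $\lim_{k\to\infty}f(x_k^* )=0\ (=f^* )$; (b) $\pi(x_k^* )\geq\pi^*:=\max_{x^*\in\Omega^*}\pi(x^* )$; (c) the sequence $\{\pi(x_k^* )\}_{k=1,2,\dots}$ is non-increasing and converges to a limit, $\lim_{k\to\infty}\pi(x_k^* )=\liminf_{k\to\infty}\pi(x_k^* )=:\pi_0$.
   Context: All integrals are with respect to Lebesgue measure on $\mathbb{R}^d$. For $k\geq 0$ the nascent minima distribution density is $$m_k(x)=\frac{e^{-kf(x)}\,\pi(x)}{\int_{\Omega}e^{-kf(t)}\,\pi(t)\,dt},\qquad x\in\Omega,$$ where $\Omega\subseteq\mathbb{R}^d$ is (measurable and) such that the denominator is a finite positive quantity for every $k\geq 0$. The paper normalizes $f$ so that $f^*=0$ (replacing $f$ by $f-f^*$ does not change $m_k$). At $k=0$ the derivative in $k$ is one-sided.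
   Formalization: In (4)(a), the limit 0 for x outside Ω* is proved only if some global minimizer has every ball around it meeting Ω in positive Lebesgue measure; without this it fails, e.g. Ω={0}∪[1,2], f(x)=x, x=1. *)

(* Defs.v *)
From HB Require Import structures.
From mathcomp Require Import all_boot all_order all_algebra.
From mathcomp Require Import all_classical all_reals all_analysis.

Set Implicit Arguments.
Unset Strict Implicit.
Unset Printing Implicit Defensive.
Import Order.TTheory GRing.Theory Num.Theory.
Import numFieldNormedType.Exports.

Local Open Scope classical_set_scope.
Local Open Scope ring_scope.

Section lebesgue_rV.
Variables (R : realType) (d : nat).
Local Notation V := 'rV[R]_d.

(* The half-open box ]c.1, c.2] and its volume (0 when some side is empty). *)
Definition box (c : V * V) : set V :=
  [set x | forall i, c.1 ord0 i < x ord0 i <= c.2 ord0 i].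

Definition box_volume (c : V * V) : R :=
  \prod_(i < d) Num.max 0 (c.2 ord0 i - c.1 ord0 i).

(* Covers are indexed by an arbitrary I : set nat, so that finite (and empty)
   covers are allowed; this matters only for d = 0, where no box is empty. *)
Definition box_cover_volume (A : set V) : set (\bar R) :=
  [set v | exists (I : set nat) (B : nat -> V * V),
     A `<=` \bigcup_(k in I) box (B k) /\
     v = (\esum_(k in I) (box_volume (B k))%:E)%E].

Definition lebesgue_outer (A : set V) : \bar R :=
  ereal_inf (box_cover_volume A).

Local Open Scope ereal_scope.

Let box_volume_ge0 c : 0 <= (box_volume c)%:E.
Proof. by rewrite lee_fin prodr_ge0// => i _; rewrite le_max lexx. Qed.

Let lebesgue_outer_ge0 A : 0 <= lebesgue_outer A.
Proof.
by apply: le_ereal_inf_tmp => _ [I [B [_ ->]]]; apply: esum_ge0 => k _.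
Qed.

Let lebesgue_outer0 : lebesgue_outer set0 = 0.
Proof.
apply/eqP; rewrite eq_le lebesgue_outer_ge0 andbT.
apply: ereal_inf_lbound; exists set0, (fun=> (0%R, 0%R)).
by rewrite esum_set0; split.
Qed.

Let le_lebesgue_outer : {homo lebesgue_outer : A B / A `<=` B >-> A <= B}.
Proof.
move=> A B AB; apply/ereal_inf_le_tmp => _ [I [C [BC ->]]].
by exists I, C; split => //; exact: subset_trans BC.
Qed.

Let lebesgue_outer_sigma_subadditive : sigma_subadditive lebesgue_outer.
Proof.
move=> A; have [[i ioo]|] := pselect (exists i, lebesgue_outer (A i) = +oo).
  rewrite (eseries_pinfty _ _ ioo) ?leey// => n _.
  by rewrite -ltNye (lt_le_trans _ (lebesgue_outer_ge0 _)).
rewrite -forallNE => Aoo.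
apply/lee_addgt0Pr => e e0.
rewrite (le_trans _ (epsilon_trick _ _ (ltW e0)))//.
pose P n (C : set nat * (nat -> V * V)) :=
  A n `<=` \bigcup_(k in C.1) box (C.2 k) /\
  \esum_(k in C.1) (box_volume (C.2 k))%:E
    <= lebesgue_outer (A n) + (e / (2 ^ n.+1)%:R)%:E.
have [G PG] : {G : nat -> set nat * (nat -> V * V) & forall n, P n (G n)}.
  apply: (@choice _ _ P) => n.
  have en : (0 < e / (2 ^ n.+1)%:R)%R by rewrite divr_gt0// ltr0n expn_gt0.
  have fA : lebesgue_outer (A n) \is a fin_num.
    by rewrite ge0_fin_numE// ltey; exact/eqP/Aoo.
  have [_ [I [B [AB ->]]] h] := lb_ereal_inf_adherent en fA.
  by exists (I, B); split => //; exact: ltW.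
have /card_esym/ppcard_eqP[f] := card_nat2.
pose I := [set n | (G (f n).1).1 (f n).2].
pose B n := (G (f n).1).2 (f n).2.
apply: (@le_trans _ _ (\esum_(n in I) (box_volume (B n))%:E)).
  apply: ereal_inf_lbound; exists I, B; split => // x [n _ Anx].
  have [k Gk xk] := (PG n).1 _ Anx.
  by exists (f^-1%FUN (n, k)); rewrite /I/= /B invK ?inE.
have -> : \esum_(n in I) (box_volume (B n))%:E =
    \sum_(n <oo) \esum_(k in (G n).1) (box_volume ((G n).2 k))%:E.
  rewrite nneseries_esumT; last by move=> n; apply: esum_ge0 => k _.
  rewrite esum_esum//.
  rewrite (reindex_esum I (setT `*`` (fun n => (G n).1)) f)//=.
  split.
  - by move=> n; rewrite /I/= => h; split.
  - by move=> x y _ _; apply: (@inj _ _ _ f); rewrite inE.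
  - move=> [n k] [_ /= Gk]; exists (f^-1%FUN (n, k)).
      by rewrite /I/= invK ?inE.
    by rewrite invK ?inE.
apply: lee_nneseries => n *; last exact: (PG n).2.
by apply: esum_ge0 => k _.
Qed.

HB.instance Definition _ := isOuterMeasure.Build R V lebesgue_outer
  lebesgue_outer0 lebesgue_outer_ge0 le_lebesgue_outer
  lebesgue_outer_sigma_subadditive.

End lebesgue_rV.

(* R^d with the sigma-algebra of Lebesgue measurable (= Caratheodory
   measurable) sets, and the Lebesgue measure on it. *)
Notation rV_leb R d := (caratheodory_type (@lebesgue_outer R d)).

Definition lebesgue_rV (R : realType) (d : nat) : set (rV_leb R d) -> \bar R :=
  @lebesgue_outer R d.

Section lebesgue_rV_measure.
Variables (R : realType) (d : nat).
Local Notation mu := (@lebesgue_rV R d).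

Let lebesgue_rV0 : mu set0 = 0%E. Proof. exact: outer_measure0. Qed.

Let lebesgue_rV_ge0 A : (0 <= mu A)%E. Proof. exact: outer_measure_ge0. Qed.

Let lebesgue_rV_sigma_additive : semi_sigma_additive mu.
Proof. exact: caratheodory_measure_sigma_additive. Qed.

HB.instance Definition _ := isMeasure.Build _ _ _ mu
  lebesgue_rV0 lebesgue_rV_ge0 lebesgue_rV_sigma_additive.

End lebesgue_rV_measure.

Section nascent_minima.
Variables (R : realType) (d : nat).
Local Notation V := 'rV[R]_d.
Local Notation leb := (@lebesgue_rV R d).
Implicit Types (Omega S : set V) (f pi p g : V -> R) (k : R) (x : V).

Definition leb_measurable S : Prop := measurable (S : set (rV_leb R d)).

Definition is_pdf S p : Prop :=
  [/\ measurable_fun (S : set (rV_leb R d)) p,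
      forall x, S x -> 0 <= p x &
      (\int[leb]_(x in S) (p x)%:E = 1)%E].

Definition prob_mass pi S : R := \int[leb]_(x in S) pi x.

(* The global minima of f on Omega, f being normalized to have minimum 0. *)
Definition minima Omega f : set V := [set x | Omega x /\ f x = 0].

Definition nmd_denom Omega f pi k : \bar R :=
  (\int[leb]_(t in Omega) (expR (- k * f t) * pi t)%:E)%E.

(* Only the values on Omega are meaningful; off Omega the same formula is used
   with the values of f and pi there, so that when f is defined on the whole
   space the gradient of nmd makes sense at every point of Omega. *)
Definition nmd Omega f pi k x : R :=
  expR (- k * f x) * pi x / fine (nmd_denom Omega f pi k).

(* Extended-real valued: for k = 0 the expectation may be +oo. *)
Definition nmd_expectation Omega f pi k : \bar R :=
  (\int[leb]_(x in Omega) (f x * nmd Omega f pi k x)%:E)%E.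

Definition nmd_maximizers Omega f pi k : set V :=
  [set x | Omega x /\
     forall y, Omega y -> nmd Omega f pi k y <= nmd Omega f pi k x].

Definition unit_vec (i : 'I_d) : V := delta_mx ord0 i.

Definition has_gradient g x : Prop := forall i, derivable g x (unit_vec i).

Definition gradient g x : V := \row_i 'D_(unit_vec i) g x.

Definition continuous_gradient g : Prop :=
  (forall x, has_gradient g x) /\
  (forall i, continuous (fun x => gradient g x ord0 i)).

Definition locally_nonnull Omega x : Prop :=
  forall e : R, 0 < e -> (0 < leb (Omega `&` ball x e))%E.

End nascent_minima.

(* Main.v *)
Require Import Defs.
From HB Require Import structures.
From mathcomp Require Import all_boot all_order all_algebra.
From mathcomp Require Import all_classical all_reals all_analysis.
From mathcomp Require Import measurable_realfun ring lra.

Set Implicit Arguments.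
Unset Strict Implicit.
Unset Printing Implicit Defensive.
Import Order.TTheory GRing.Theory Num.Theory.
Import numFieldNormedType.Exports.

Local Open Scope classical_set_scope.
Local Open Scope ring_scope.

(** The density is a Gibbs measure: its normalization Z(k), the integral of
exp(- k f) pi over Omega, is the Laplace transform of the law of f under pi,
and log m_k = - k f + log pi - log Z(k).  All the claims are read off this
identity and off the behaviour of Z.

The gradient formula is immediate, since Z(k) does not depend on the point.
For the derivative in k, what is needed is - Z'(k) / Z(k) = E_{m_k}(f).  When
k > 0 one may differentiate under the integral, because f exp(- t f) is at most
2 / k for t > k / 2, whatever the growth of f ([is_derive_laplace]).  At k = 0
there is no such domination and the expectation can be infinite.  There, the
difference quotient (Z(0) - Z(h)) / h is squeezed between the integrals of
f exp(- h f) pi and of f pi, the first of which increases to the second by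
monotone convergence, and log is linearized by
(a - b) / a <= ln a - ln b <= (a - b) / b ([cvg_ln_laplace_slope0]).

As k tends to infinity, exp(- k f) decreases to the indicator of the minima,
so Z(k) tends to the Pi-mass of the minima ([cvg_laplace_pinfty]); this gives
the limits of m_k at the minima.  Elsewhere one needs a lower bound for Z: if
f <= c on a set A then Z(k) >= exp(- k c) Pi(A), so that m_k(x) decays like
exp(- k (f(x) - c)) as soon as c < f(x) and Pi(A) > 0 ([nmd_cvg0]).  The set A
is the set of minima itself when it is not null, and otherwise a neighbourhood
in Omega of a minimum around which Omega is not null.

The claims on maximizers involve no integral: Z(k) cancels in a comparison of
two values of m_k, and a maximizer of m_k is a maximizer of - k f + log pi.
Comparing with a minimum y of f bounds k f(x_k) by log sup pi - log pi(y)
and gives pi(x_k) >= pi(y).  Comparing the maximizers for j < k with each other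
gives f(x_k) <= f(x_j) and then pi(x_k) <= pi(x_j) ([maximizer_pi_le]).

All of this presupposes that f is measurable, hence that open sets are
measurable in the sense of Caratheodory for the outer measure defined by boxes.
This comes down to half-spaces, which cut a box into two boxes whose volumes add
up ([halfspace_measurable]). *)

(** * Continuous functions are Lebesgue measurable *)

Section open_measurable.
Variables (R : realType) (d : nat).
Local Notation V := 'rV[R]_d.

Lemma box_volume_ge0 (c : V * V) : 0 <= box_volume c.
Proof. by rewrite prodr_ge0// => i _; rewrite le_max lexx. Qed.

Definition box_below (i : 'I_d) (a : R) (c : V * V) : V * V :=
  (c.1, \row_j (if j == i then Num.min (c.2 ord0 j) a else c.2 ord0 j)).

Definition box_above (i : 'I_d) (a : R) (c : V * V) : V * V :=
  (\row_j (if j == i then Num.max (c.1 ord0 j) a else c.1 ord0 j), c.2).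

(** The equality also holds for empty boxes and for cuts that miss the box: then
at least one of the two pieces has an empty side, of length truncated to 0. *)
Lemma box_volume_split i a c :
  box_volume c = box_volume (box_below i a c) + box_volume (box_above i a c).
Proof.
rewrite /box_volume [LHS](bigD1 i)//= [X in _ = X + _](bigD1 i)//=.
rewrite [X in _ = _ + X](bigD1 i)//=.
rewrite !mxE eqxx.
under [X in _ = _ * X + _]eq_bigr => j /negbTE ji do rewrite mxE ji.
under [X in _ = _ + _ * X]eq_bigr => j /negbTE ji do rewrite mxE ji.
rewrite -mulrDl; congr (_ * _).
set l := c.1 ord0 i; set r := c.2 ord0 i.
by rewrite /Num.max /Num.min; repeat case: ifPn; move=> *; lra.
Qed.

Lemma sub_box_below i a c :
  box c `&` [set x | x ord0 i <= a] `<=` box (box_below i a c).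
Proof.
move=> x [cx xa] j; have /andP[lx xr] := cx j; rewrite lx/= mxE.
by case: eqP => [ji|//]; rewrite le_min xr ji.
Qed.

Lemma sub_box_above i a c :
  box c `&` ~` [set x | x ord0 i <= a] `<=` box (box_above i a c).
Proof.
move=> x [cx /negP xa] j; have /andP[lx xr] := cx j; rewrite xr andbT/= mxE.
by case: eqP => [ji|//]; rewrite gt_max lx ji ltNge.
Qed.

(** A cover of X by boxes, cut along the hyperplane, yields covers of the two
parts of X whose total volume is unchanged; taking the infimum gives the
nontrivial half of Caratheodory's criterion. *)
Lemma halfspace_measurable (i : 'I_d) (a : R) :
  leb_measurable [set x : V | x ord0 i <= a].
Proof.
apply: le_caratheodory_measurable => X.
apply: le_ereal_inf_tmp => _ [I [B [XB ->]]].
under eq_esum do rewrite (box_volume_split i a) EFinD.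
rewrite esumD; try by move=> k _; rewrite lee_fin box_volume_ge0.
have half (H : set V) (s : V * V -> V * V) :
    (forall c, box c `&` H `<=` box (s c)) ->
    (lebesgue_outer (X `&` H) <= \esum_(k in I) (box_volume (s (B k)))%:E)%E.
  move=> sH; apply: ereal_inf_lbound; exists I, (s \o B); split => //.
  by move=> x [/XB[k Ik Bx] Hx]; exists k => //; apply: sH.
by apply: leeD; apply: half => c; [exact: sub_box_below|exact: sub_box_above].
Qed.

(** An open set is the union of the boxes with rational corners that it
contains, and these are countably many finite intersections of half-spaces and
complements of half-spaces. *)
Lemma open_leb_measurable (U : set V) : open U -> leb_measurable U.
Proof.
move=> oU.
pose Q (p : 'rV[rat]_d * 'rV[rat]_d) : set V := [set x : V | forall i,
  ratr (p.1 ord0 i) < x ord0 i <= ratr (p.2 ord0 i)].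
(* Discarding the boxes not included in U lets the union range over a type. *)
pose QU p := if `[< Q p `<=` U >] then Q p else set0.
have -> : U = \bigcup_p QU p.
  apply/seteqP; split => [x Ux|x [p _]]; last first.
    by rewrite /QU; case: asboolP => [QpU /QpU//|_ []].
  have /nbhs_ballP[e /= e0 xeU] : nbhs x U by exact: open_nbhs_nbhs.
  have /choice[q qx] (i : 'I_d) : exists q : rat, x ord0 i - e < ratr q < x ord0 i.
    have /rat_in_itvoo[q] : x ord0 i - e < x ord0 i by rewrite ltrBlDr ltrDl.
    by rewrite in_itv/= => qx; exists q.
  have /choice[r rx] (i : 'I_d) : exists r : rat, x ord0 i < ratr r < x ord0 i + e.
    have /rat_in_itvoo[r] : x ord0 i < x ord0 i + e by rewrite ltrDl.
    by rewrite in_itv/= => rx; exists r.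
  pose p : 'rV[rat]_d * 'rV[rat]_d := (\row_i q i, \row_i r i).
  exists p => //; rewrite /QU.
  have -> : `[< Q p `<=` U >] = true.
    apply/asboolP => y Qy; apply: xeU; split => // i j; rewrite ord1.
    have /andP[] := Qy j; rewrite !mxE => qy yr.
    have /andP[q1 _] := qx j; have /andP[_ r2] := rx j.
    rewrite /ball/= ltr_distlC; apply/andP; split.
      exact: lt_trans qy.
    exact: le_lt_trans r2.
  move=> i; rewrite !mxE.
  by have /andP[_ ->] := qx i; have /andP[/ltW -> _] := rx i.
apply: countable_bigcupT_measurable; first exact: countableP.
move=> p; rewrite /QU; case: asboolP => _; last exact: measurable0.
have -> : Q p = \bigcap_(i in [set: 'I_d])
    ([set x | x ord0 i <= ratr (p.2 ord0 i)] `&`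
     ~` [set x | x ord0 i <= ratr (p.1 ord0 i)]).
  apply/seteqP; split=> [x Qx i _|x Qx i] /=.
    by have /andP[? ?] := Qx i; split => //; apply/negP; rewrite -ltNge.
  by have [/= -> /negP] := Qx i I; rewrite -ltNge => ->.
apply: fin_bigcap_measurable => // i _; apply: measurableI.
  exact: halfspace_measurable.
by apply: measurableC; exact: halfspace_measurable.
Qed.

Lemma within_continuous_leb_measurable (D : set V) (f : V -> R) :
  leb_measurable D -> {within D, continuous f} ->
  measurable_fun (D : set (rV_leb R d)) f.
Proof.
move=> mD cf; apply: (measurability _ (RGenOpens.measurableE R)) => _ [_ [a [b ->] <-]].
have /continuousP/(_ _ (@interval_open R (BRight a) (BLeft b) erefl erefl)) := cf.
move=> /open_subspaceP[U oU UD]; rewrite setIC -UD.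
by apply: measurableI => //; exact: open_leb_measurable.
Qed.

End open_measurable.

(** * Elementary bounds, integrals and directional derivatives *)

(** exp(a y) >= 1 + a y >= a y. *)
Lemma mul_expRN_le (R : realType) (a y : R) : 0 < a -> y * expR (- a * y) <= a^-1.
Proof.
move=> a0; rewrite mulNr expRN ler_pdivrMr ?expR_gt0// ler_pdivlMl//.
by apply: le_trans (expR_ge1Dx _); rewrite lerDr.
Qed.

(** Both bounds are the inequality ln (1 + t) <= t, for t = a / b - 1 and for
t = b / a - 1. *)
Lemma ln_ratio_bounds (R : realType) (a b : R) : 0 < a -> 0 < b ->
  (a - b) / a <= ln a - ln b <= (a - b) / b.
Proof.
have ub (x y : R) : 0 < x -> 0 < y -> ln x - ln y <= (x - y) / y.
  move=> x0 y0; rewrite -ln_div ?posrE//.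
  have -> : (x - y) / y = x / y - 1 by rewrite mulrBl divff// gt_eqF.
  have xy0 : 0 < x / y by rewrite divr_gt0.
  rewrite -[in leLHS](subrK 1 (x / y)) addrC; apply: le_ln1Dx; lra.
move=> a0 b0; rewrite ub// andbT -(opprB (ln b)) lerNr.
by apply: le_trans (ub _ _ b0 a0) _; rewrite -mulNr opprB.
Qed.

(** If the integral were 0 then w would vanish almost everywhere on A. *)
Lemma Rintegral_gt0 d (T : measurableType d) (R : realType)
    (mu : {measure set T -> \bar R}) (A : set T) (w : T -> R) :
    measurable A -> mu.-integrable A (EFin \o w) ->
    (forall x, A x -> 0 < w x) -> (0 < mu A)%E ->
  0 < \int[mu]_(x in A) w x.
Proof.
move=> mA iw w_gt0 muA; rewrite lt_neqAle Rintegral_ge0; last first.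
  by move=> x /w_gt0/ltW.
rewrite andbT; apply/negP => /eqP int0.
have : (\int[mu]_(x in A) `|(EFin \o w) x| = 0)%E.
  transitivity (\int[mu]_(x in A) w x)%:E; last by rewrite -int0.
  rewrite fineK; last exact: integrable_fin_num.
  by apply: eq_integral => x /[!inE] /w_gt0 wx /=; rewrite gtr0_norm.
have mw := measurable_int _ iw.
move=> /(ae_eq_integral_abs mu mA mw) w_ae0.
suff : mu A = 0%E by move=> A0; move: muA; rewrite A0 ltxx.
apply: measure_negligible => //; apply: negligibleS w_ae0 => x Ax /= /(_ Ax) [wx0].
by have := w_gt0 _ Ax; rewrite wx0 ltxx.
Qed.

(** A directional derivative is the ordinary derivative along a line, which makes
the chain rule for functions of one real variable available. *)
Lemma is_derive_line (R : realType) (V : normedModType R) (p : V -> R)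
    (x v : V) (dp : R) :
  is_derive x v p dp <-> is_derive (0 : R) 1 (fun h : R => p (h *: v + x)) dp.
Proof.
have E : (fun h : R => h^-1 *: ((p \o shift x) (h *: v) - p x)) =
    (fun h : R => h^-1 *: (((fun h => p (h *: v + x)) \o shift 0) (h *: 1)
       - p (0 *: v + x))).
  by apply/funext => h /=; rewrite scale0r add0r addr0 [h *: 1]mulr1.
have ED : 'D_v p x = 'D_1 (fun h : R => p (h *: v + x)) (0 : R) by rewrite /derive E.
by split => -[dv <-]; split; rewrite ?ED//; move: dv; rewrite /derivable E.
Qed.

Lemma is_derive_ln (R : realType) (V : normedModType R) (p : V -> R)
    (x v : V) (dp : R) :
  0 < p x -> is_derive x v p dp -> is_derive x v (@ln R \o p) ((p x)^-1 * dp).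
Proof.
move=> px /is_derive_line dl; apply/is_derive_line.
apply: (@is_derive1_comp _ (@ln R) (fun h : R => p (h *: v + x)) 0 _ dp).
have -> : p x = p (0 *: v + x) by rewrite scale0r add0r.
by apply: is_derive1_ln; rewrite scale0r add0r.
Qed.

(** * Laplace transforms *)

Section laplace.
Context d (T : measurableType d) (R : realType) (mu : {measure set T -> \bar R}).
Variables (D : set T) (f w : T -> R).
Hypothesis mD : measurable D.
Hypothesis mf : measurable_fun D f.
Hypothesis f0 : forall x, D x -> 0 <= f x.
Hypothesis w0 : forall x, 0 <= w x.
Hypothesis iw : mu.-integrable D (EFin \o w).

Let tilt (k : R) (x : T) : R := expR (- k * f x) * w x.

(** The Laplace transform of the image by f of the measure of density w. *)
Definition laplace (k : R) : R := \int[mu]_(x in D) (expR (- k * f x) * w x).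

Lemma tilt_le (k : R) x : 0 <= k -> D x -> 0 <= expR (- k * f x) * w x <= w x.
Proof.
move=> k0 Dx; rewrite mulr_ge0 ?expR_ge0//= ler_piMl//.
by rewrite -expR0 ler_expR mulNr oppr_le0 mulr_ge0// f0.
Qed.

Let mw : measurable_fun D w.
Proof. by have /integrableP[/measurable_EFinP] := iw. Qed.

Lemma measurable_tilt k : measurable_fun D (fun x => expR (- k * f x) * w x).
Proof.
apply: measurable_funM => //; apply: measurableT_comp => //.
by apply: measurable_funM => //; exact: measurable_cst.
Qed.

Lemma integrable_tilt (k : R) : 0 <= k ->
  mu.-integrable D (fun x => (expR (- k * f x) * w x)%:E).
Proof.
move=> k0; apply: (le_integrable _ _ _ iw) => //.
  exact/measurable_EFinP/measurable_tilt.
move=> x Dx /=; have /andP[t0 tw] := tilt_le k0 Dx.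
by rewrite lee_fin ger0_norm// ger0_norm.
Qed.

Lemma laplaceE (k : R) : 0 <= k ->
  (laplace k)%:E = (\int[mu]_(x in D) (expR (- k * f x) * w x)%:E)%E.
Proof.
by move=> k0; rewrite fineK//; apply: integrable_fin_num => //; exact: integrable_tilt.
Qed.

Lemma mul_tilt_le (k : R) x : 0 < k -> D x ->
  `|f x * (expR (- k * f x) * w x)| <= k^-1 * w x.
Proof.
move=> k0 Dx; have /andP[t0 _] := tilt_le (ltW k0) Dx.
by rewrite ger0_norm ?mulr_ge0 ?f0// mulrA ler_wpM2r// mul_expRN_le.
Qed.

Lemma integrable_scaled (c : R) : mu.-integrable D (EFin \o (fun x => c * w x)).
Proof. by rewrite /comp; under eq_fun do rewrite EFinM; exact: integrableZl. Qed.

Lemma integrable_mul_tilt (k : R) : 0 < k ->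
  mu.-integrable D (fun x => (f x * (expR (- k * f x) * w x))%:E).
Proof.
move=> k0; apply: (le_integrable _ _ _ (integrable_scaled k^-1)) => //.
  by apply/measurable_EFinP/measurable_funM => //; exact: measurable_tilt.
by move=> x Dx /=; rewrite lee_fin (le_trans (mul_tilt_le k0 Dx))// ler_norm.
Qed.

Let is_derive_tilt (k : R) x :
  is_derive k 1 (tilt ^~ x) (- (f x * (expR (- k * f x) * w x))).
Proof.
have swap t : - t * f x = - f x * t by rewrite !mulNr mulrC.
have -> : tilt ^~ x = w x \*: (expR \o (- f x \*: id)) :> (R -> R).
  by rewrite funeqE => t; rewrite /tilt swap mulrC.
by apply: is_derive_eq; rewrite swap /GRing.scale/=; ring.
Qed.

(** On ]k / 2, k + 1[ the parameter derivative - f exp(- t f) w is dominated by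
(2 / k) w, which is integrable even when f w is not. *)
Lemma is_derive_laplace (k : R) : 0 < k ->
  is_derive k 1 laplace (- \int[mu]_(x in D) (f x * (expR (- k * f x) * w x))).
Proof.
move=> k0.
have Ik : `]k / 2, k + 1[%classic k by rewrite /= in_itv/=; apply/andP; split; lra.
have I0 t : `]k / 2, k + 1[%classic t -> k / 2 < t by rewrite /= in_itv/= => /andP[].
have k20 : 0 < k / 2 by rewrite divr_gt0.
have intf t : `]k / 2, k + 1[%classic t -> mu.-integrable D (EFin \o tilt t).
  by move=> /I0 kt; apply: integrable_tilt; rewrite ltW// (lt_trans k20).
have der t y : `]k / 2, k + 1[%classic t -> D y -> derivable (tilt ^~ y) t 1.
  by move=> _ _; have [] := is_derive_tilt t y.
have parE t y : partial1of2 tilt t y = - (f y * (expR (- t * f y) * w y)).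
  by rewrite partial1of2E; have [_ ->] := is_derive_tilt t y.
have G0 y : 0 <= (k / 2)^-1 * w y by rewrite mulr_ge0// invr_ge0 ltW.
have ub t y : `]k / 2, k + 1[%classic t -> D y ->
    `|partial1of2 tilt t y| <= (k / 2)^-1 * w y.
  move=> /I0 kt Dy; have t0 := lt_trans k20 kt.
  rewrite parE normrN (le_trans (mul_tilt_le t0 Dy))// ler_wpM2r//.
  by rewrite lef_pV2 ?posrE// ltW.
have intG := integrable_scaled (k / 2)^-1.
split; first exact: (derivable_under_integral mD Ik intf der G0 intG ub).
rewrite -derive1E.
rewrite (differentiation_under_integral mD Ik intf der G0 intG ub).
under eq_Rintegral do rewrite parE -mulN1r.
rewrite RintegralZl ?mulN1r//; exact: integrable_mul_tilt.
Qed.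

(** Dominated convergence, with w as dominating function.  The limits of the
Laplace transform at 0 and at infinity are two instances of it. *)
Lemma cvg_laplace_seq (u : R^nat) (g : T -> R) :
    (\forall n \near \oo, 0 <= u n) ->
    (forall x, D x -> expR (- u n * f x) @[n --> \oo] --> g x) ->
  laplace (u n) @[n --> \oo] --> \int[mu]_(x in D) (g x * w x).
Proof.
move=> [N _ u0] ug; rewrite -(cvg_shiftn N).
have uN n : 0 <= u (n + N)%N by apply: u0; rewrite /= leq_addl.
have mt n : measurable_fun D (fun x => (tilt (u (n + N)%N) x)%:E).
  exact/measurable_EFinP/measurable_tilt.
have tg x : D x -> (tilt (u (n + N)%N) x)%:E @[n --> \oo] --> (g x * w x)%:E.
  move=> Dx; apply: cvg_EFin; first exact: nearW.
  apply: cvgMr_tmp; rewrite (cvg_shiftn N (fun n => expR (- u n * f x))); exact: ug.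
have tw n x : D x -> (`|(tilt (u (n + N)%N) x)%:E| <= (EFin \o w) x)%E.
  move=> Dx; have /andP[t0 t1] := tilt_le (uN n) Dx.
  by rewrite lee_fin ger0_norm.
have [ig _ lim] := dominated_convergence mD mt
  (emeasurable_fun_cvg _ _ mt tg) (aeW _ tg) iw (aeW _ (fun x n Dx => tw n x Dx)).
apply: fine_cvg; rewrite fineK//; exact: (integrable_fin_num mD).
Qed.

Lemma cvg_laplace_at0 : laplace h @[h --> 0^'+] --> laplace 0.
Proof.
apply/cvg_at_rightP => u [u0 ul].
have -> : laplace 0 = \int[mu]_(x in D) (1 * w x).
  by apply: eq_Rintegral => x _; rewrite oppr0 mul0r expR0.
apply: cvg_laplace_seq => [|x Dx]; first by apply: nearW => n; rewrite ltW.
rewrite -[X in _ --> X]expR0; apply: continuous_cvg; first exact: continuous_expR.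
by rewrite -[X in _ --> X](mul0r (f x)) -oppr0; apply: cvgMr_tmp; exact: cvgN.
Qed.

(** exp(- k f) tends to the indicator function of the zeros of f. *)
Lemma cvg_laplace_pinfty :
  laplace k @[k --> +oo] --> \int[mu]_(x in D `&` [set x | f x = 0]) w x.
Proof.
apply/cvg_pinftyP => u uoo; rewrite Rintegral_mkcondr.
have -> : \int[mu]_(x in D) (w \_ [set x | f x = 0]) x =
          \int[mu]_(x in D) ((f x == 0)%:R * w x).
  apply: eq_Rintegral => x _; rewrite patchE; case: ifPn => [|/negP fx].
    by rewrite inE/= => ->; rewrite eqxx mul1r.
  by case: eqP => [fx0|]; rewrite ?mul0r//; case: fx; rewrite inE.
apply: cvg_laplace_seq => [|x Dx]; first by move/cvgryPge : uoo; exact.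
have [->|fx0] := eqVneq (f x) 0.
  by under eq_fun do rewrite mulr0 expR0; exact: cvg_cst.
have {fx0} fx0 : 0 < f x by rewrite lt_neqAle eq_sym fx0 f0.
have /= := cvg_comp _ _ (cvg_comp _ _ uoo (gt0_cvgMry fx0 cvg_id)) (@cvgr_expR R).
by rewrite /comp; under eq_fun do rewrite mulrC -mulNr; apply.
Qed.

(** The contribution of a sublevel set: the Laplace transform decays no faster
than exp(- k c) when f <= c on a set of positive mass. *)
Lemma laplace_ge (k c : R) (A : set T) : measurable A -> A `<=` D -> 0 <= k ->
    (forall x, A x -> f x <= c) ->
  expR (- k * c) * \int[mu]_(x in A) w x <= laplace k.
Proof.
move=> mA AD k0 fc.
have iwA := integrableS mD mA AD iw.
rewrite -RintegralZl//.
have iA := integrableS mD mA AD (integrable_tilt k0).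
rewrite (@le_trans _ _ (\int[mu]_(x in A) (expR (- k * f x) * w x)))//.
  apply: le_Rintegral => //.
    by rewrite /comp; under eq_fun do rewrite EFinM; exact: integrableZl.
  by move=> x Ax; rewrite ler_wpM2r// ler_expR !mulNr lerN2 ler_wpM2l// fc.
apply: fine_le.
- exact: integrable_fin_num.
- exact: integrable_fin_num (integrable_tilt k0).
- apply: ge0_subset_integral => //; first exact/measurable_EFinP/measurable_tilt.
  by move=> x Dx; rewrite lee_fin; have /andP[] := tilt_le k0 Dx.
Qed.

(** The integral is nonincreasing in h, so its right limit at 0 exists and can
be computed along the sequence 1 / (n + 1), where monotone convergence applies.
The common limit may be infinite. *)
Lemma cvg_mean_at0 :
  (\int[mu]_(x in D) (f x * (expR (- h * f x) * w x))%:E)%E @[h --> 0^'+] -->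
  (\int[mu]_(x in D) (f x * w x)%:E)%E.
Proof.
pose F h : \bar R := (\int[mu]_(x in D) (f x * (expR (- h * f x) * w x))%:E)%E.
have mF h : measurable_fun D (fun x => (f x * (expR (- h * f x) * w x))%:E).
  by apply/measurable_EFinP/measurable_funM => //; exact: measurable_tilt.
have F0 h x : D x -> (0 <= (f x * (expR (- h * f x) * w x))%:E)%E.
  by move=> Dx; rewrite lee_fin !mulr_ge0 ?f0 ?expR_ge0.
have Fle (h h' : R) x : h <= h' -> D x ->
    ((f x * (expR (- h' * f x) * w x))%:E <= (f x * (expR (- h * f x) * w x))%:E)%E.
  move=> hh Dx; rewrite lee_fin ler_wpM2l ?f0// ler_wpM2r// ler_expR.
  by rewrite ler_wpM2r ?f0// lerN2.
have Fni : {in `]0, 1[ &, nonincreasing_fun F}.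
  by move=> h h' _ _ hh; apply: ge0_le_integral => //; [exact: F0|move=> x; exact: Fle].
have itv01 : (BRight (0 : R) < BLeft (1 : R))%O by rewrite bnd_simp.
have Fsup := nonincreasing_at_right_cvge _ itv01 Fni.
suff <- : ereal_sup (F @` [set` `]0, 1[]) = (\int[mu]_(x in D) (f x * w x)%:E)%E.
  exact: Fsup.
have Fharm : F (@harmonic R n) @[n --> \oo] --> ereal_sup (F @` [set` `]0, 1[]).
  apply: cvg_comp Fsup => P P0.
  have h : \forall n \near \oo, 0 < @harmonic R n -> P (harmonic n).
    exact: (@cvg_harmonic R _ P0).
  suff : \forall n \near \oo, P (harmonic n) by [].
  by apply: filterS h => n; apply; exact: harmonic_gt0.
apply: (cvg_unique _ Fharm); first exact: ereal_hausdorff.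
have flim x : D x ->
    (f x * (expR (- (@harmonic R n) * f x) * w x))%:E @[n --> \oo] --> (f x * w x)%:E.
  move=> Dx; apply: cvg_EFin; first exact: nearW.
  rewrite -[X in _ * X]mul1r; apply: cvgMl_tmp; apply: cvgMr_tmp.
  rewrite -expR0; apply: continuous_cvg; first exact: continuous_expR.
  rewrite -(mul0r (f x)) -oppr0; apply: cvgMr_tmp; apply: cvgN.
  exact: cvg_harmonic.
have -> : (\int[mu]_(x in D) (f x * w x)%:E)%E = (\int[mu]_(x in D)
    limn (fun n => (f x * (expR (- (@harmonic R n) * f x) * w x))%:E))%E.
  by apply: eq_integral => x /[!inE] Dx; apply/esym/cvg_lim => //; exact: flim.
apply: cvg_monotone_convergence => // [n x|x Dx m n mn]; first exact: F0.
by apply: Fle => //; rewrite /harmonic/= lef_pV2 ?posrE// ler_nat ltnS.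
Qed.

(** With F(h) the integral of f exp(- h f) w and E that of f w, the inequalities
f exp(- h f) <= (1 - exp(- h f)) / h <= f give
F(h) <= (laplace 0 - laplace h) / h <= E, and [ln_ratio_bounds] then places the
slope of ln between F(h) / laplace 0 and E / laplace h.  Both bounds tend to
E / laplace 0, including when E is infinite. *)
Lemma cvg_ln_laplace_slope0 : (forall k : R, 0 <= k -> 0 < laplace k) ->
  ((ln (laplace 0) - ln (laplace h)) / h)%:E @[h --> 0^'+] -->
  ((laplace 0)^-1%:E * \int[mu]_(x in D) (f x * w x)%:E)%E.
Proof.
move=> Lgt0.
set E := (\int[mu]_(x in D) (f x * w x)%:E)%E.
pose F h : \bar R := (\int[mu]_(x in D) (f x * (expR (- h * f x) * w x))%:E)%E.
have wh x h : (w x - expR (- h * f x) * w x) / h =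
    (1 - expR (- h * f x)) / h * w x.
  by rewrite [RHS]mulrAC; congr (_ / _); rewrite mulrBl mul1r.
have slopeE h : 0 < h -> ((laplace 0 - laplace h) / h)%:E =
    (\int[mu]_(x in D) ((1 - expR (- h * f x)) / h * w x)%:E)%E.
  move=> h0; have h0' := ltW h0.
  rewrite mulrC EFinM EFinB !laplaceE//.
  rewrite -integralB_EFin//; try exact: integrable_tilt.
  rewrite -integralZl//; last first.
    under eq_fun do rewrite -EFinB.
    rewrite (_ : (fun _ => _) = (fun x => (expR (- 0 * f x) * w x)%:E)
      \- (fun x => (expR (- h * f x) * w x)%:E))%E//.
    by apply: integrableB => //; exact: integrable_tilt.
  apply: eq_integral => x _; rewrite -EFinB -EFinM -wh// oppr0 mul0r expR0 mul1r.
  by rewrite mulrC.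
have mslope h : measurable_fun D (fun x => ((1 - expR (- h * f x)) / h * w x)%:E).
  apply/measurable_EFinP; under eq_fun do rewrite mulrAC mulrBl mul1r.
  apply: measurable_funM; last exact: measurable_cst.
  by apply: measurable_funB => //; exact: measurable_tilt.
have slope_ge h : 0 < h -> (F h <= ((laplace 0 - laplace h) / h)%:E)%E.
  move=> h0; rewrite slopeE//; apply: ge0_le_integral => //.
  - by move=> x Dx; rewrite lee_fin !mulr_ge0 ?f0 ?expR_ge0.
  - by apply/measurable_EFinP/measurable_funM => //; exact: measurable_tilt.
  move=> x Dx; rewrite lee_fin mulrA ler_wpM2r// ler_pdivlMr//.
  have := expR_ge1Dx (h * f x); rewrite mulNr expRN => e1.
  have e0 := expR_gt0 (h * f x).
  rewrite lerBrDr -(ler_pM2r e0) mul1r.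
  suff -> : (f x / expR (h * f x) * h + (expR (h * f x))^-1) * expR (h * f x) =
    1 + h * f x by [].
  by field; rewrite gt_eqF.
have slope_le h : 0 < h -> (((laplace 0 - laplace h) / h)%:E <= E)%E.
  move=> h0; rewrite slopeE//; apply: ge0_le_integral => //.
  - move=> x Dx; rewrite lee_fin mulr_ge0// divr_ge0 ?(ltW h0)// subr_ge0.
    by rewrite -expR0 ler_expR mulNr oppr_le0 mulr_ge0 ?f0 ?(ltW h0).
  - by apply/measurable_EFinP/measurable_funM.
  move=> x Dx; rewrite lee_fin ler_wpM2r// ler_pdivrMr//.
  by have := expR_ge1Dx (- h * f x); rewrite mulNr mulrC; lra.
have L0 := Lgt0 0 (lexx 0).
apply: (@squeeze_cvge _ _ _ _ (fun h => (laplace 0)^-1%:E * F h)%E _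
    (fun h => (laplace h)^-1%:E * E)%E).
- near=> h; have h0 : 0 < h by near: h; exact: nbhs_right_gt.
  have Lh := Lgt0 h (ltW h0).
  have /andP[lo up] := ln_ratio_bounds L0 Lh.
  apply/andP; split.
    apply: (@le_trans _ _ ((laplace 0)^-1%:E * ((laplace 0 - laplace h) / h)%:E)%E).
      by rewrite lee_pmul2l ?slope_ge// lte_fin invr_gt0.
    by rewrite -EFinM lee_fin mulrCA mulrA ler_wpM2r// ?invr_ge0 ?(ltW h0).
  apply: (@le_trans _ _ ((laplace h)^-1%:E * ((laplace 0 - laplace h) / h)%:E)%E).
    by rewrite -EFinM lee_fin mulrCA mulrA ler_wpM2r// ?invr_ge0 ?(ltW h0).
  by rewrite lee_pmul2l ?slope_le// lte_fin invr_gt0.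
- apply: cvgeZl => //; exact: cvg_mean_at0.
- apply: cvgeM; last exact: cvg_cst.
    have [Efin|Einf] := boolP (E \is a fin_num); first exact: mule_def_fin.
    by apply: mule_def_neq0_infty => //; rewrite gt_eqF// lte_fin invr_gt0.
  apply: cvg_EFin; first exact: nearW.
  apply: cvgV; [by rewrite gt_eqF|exact: cvg_laplace_at0].
Unshelve. all: by end_near. Qed.

End laplace.

(** * The nascent minima distribution *)

Section nascent_minima.
Variables (R : realType) (d : nat) (Omega : set 'rV[R]_d) (f pi : 'rV[R]_d -> R).
Local Notation V := 'rV[R]_d.
Local Notation leb := (@lebesgue_rV R d).
Hypothesis mOmega : leb_measurable Omega.
Hypothesis cf : {within Omega, continuous f}.
Hypothesis f0 : forall x, Omega x -> 0 <= f x.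
Hypothesis pdf_pi : is_pdf setT pi.
Hypothesis pi_gt0 : forall x, 0 < pi x.
Hypothesis denom_gt0 : forall k : R, 0 <= k -> (0 < nmd_denom Omega f pi k < +oo)%E.

Local Notation m := (nmd Omega f pi).
Local Notation L := (laplace leb Omega f pi).

Let mD : measurable (Omega : set (rV_leb R d)) := mOmega.

Let mf : measurable_fun (Omega : set (rV_leb R d)) f.
Proof. exact: within_continuous_leb_measurable. Qed.

Let pi_ge0 x : 0 <= pi x. Proof. exact: ltW. Qed.

Let integrable_piT : leb.-integrable setT (EFin \o pi).
Proof.
have [mpi _ int1] := pdf_pi; apply/integrableP; split.
  exact/measurable_EFinP.
rewrite (_ : \int[_]_(x in _) _ = 1)%E ?ltry// -int1.
by apply: eq_integral => x _ /=; rewrite ger0_norm.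
Qed.

Let ipi (A : set V) : leb_measurable A -> leb.-integrable A (EFin \o pi).
Proof. by move=> mA; apply: (integrableS _ _ _ integrable_piT). Qed.

Let L_gt0 (k : R) : 0 <= k -> 0 < L k.
Proof. by move=> /denom_gt0 k0; exact: fine_gt0. Qed.

Let m_gt0 (k : R) x : 0 <= k -> 0 < m k x.
Proof. by move=> k0; rewrite divr_gt0 ?mulr_gt0 ?expR_gt0 ?L_gt0. Qed.

Lemma nmd_is_pdf (k : R) : 0 <= k -> is_pdf Omega (m k).
Proof.
move=> k0; split.
- apply: measurable_funM; last exact: measurable_cst.
  by apply: measurable_tilt => //; exact: ipi.
- by move=> x _; exact/ltW/m_gt0.
under eq_integral do rewrite EFinM.
rewrite integralZr//; last by apply: integrable_tilt => //; exact: ipi.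
rewrite -(laplaceE mD mf f0 pi_ge0 (ipi mOmega) k0) -EFinM divff//.
by rewrite gt_eqF// L_gt0.
Qed.

Lemma nmd0 x : m 0 x = pi x / prob_mass pi Omega.
Proof.
rewrite /nmd oppr0 mul0r expR0 mul1r; congr (_ / _).
by apply: eq_Rintegral => y _; rewrite oppr0 mul0r expR0 mul1r.
Qed.

Lemma ln_nmd (k : R) x : 0 <= k -> ln (m k x) = - k * f x + ln (pi x) - ln (L k).
Proof.
move=> k0; rewrite ln_div ?posrE ?mulr_gt0 ?expR_gt0 ?L_gt0//.
by rewrite lnM ?posrE ?expR_gt0// expRK.
Qed.

Lemma gradient_ln_nmd (k : R) x : continuous_gradient pi -> continuous_gradient f ->
    0 <= k ->
  has_gradient (fun y => ln (m k y)) x /\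
  gradient (fun y => ln (m k y)) x =
    - k *: gradient f x + (pi x)^-1 *: gradient pi x.
Proof.
move=> [dpi _] [df _] k0.
have D i : is_derive x (unit_vec R i) (fun y => ln (m k y))
    (- k * 'D_(unit_vec R i) f x + (pi x)^-1 * 'D_(unit_vec R i) pi x).
  have -> : (fun y => ln (m k y)) = (- k \*: f) + (@ln R \o pi) - cst (ln (L k)).
    by apply/funext => y; rewrite ln_nmd.
  have df' := derivableP (df x i).
  have dpi' := is_derive_ln (pi_gt0 x) (derivableP (dpi x i)).
  by apply: is_derive_eq; rewrite subr0.
split; first by move=> i; have [] := D i.
by apply/rowP => i; rewrite !mxE; have [_ ->] := D i.
Qed.

Lemma nmd_expectationE (k : R) : 0 <= k -> nmd_expectation Omega f pi k =
  ((L k)^-1%:E * \int[leb]_(x in Omega) (f x * (expR (- k * f x) * pi x))%:E)%E.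
Proof.
move=> k0; rewrite -ge0_integralZl//.
- by apply: eq_integral => x _; rewrite -EFinM /nmd mulrA mulrC.
- apply/measurable_EFinP/measurable_funM => //.
  by apply: measurable_tilt => //; exact: ipi.
- by move=> x Ox; rewrite lee_fin !mulr_ge0 ?f0 ?expR_ge0.
- by rewrite lee_fin invr_ge0 ltW// L_gt0.
Qed.

Lemma is_derive_ln_nmd (k : R) x : 0 < k ->
  nmd_expectation Omega f pi k \is a fin_num /\
  is_derive k 1 (fun t => ln (m t x))
    (fine (nmd_expectation Omega f pi k) - f x).
Proof.
move=> k0; have k0' := ltW k0.
have int_fin := integrable_fin_num mD
  (integrable_mul_tilt mD mf f0 pi_ge0 (ipi mOmega) k0).
rewrite nmd_expectationE//; split; first by rewrite fin_numM.
rewrite fineM// -/(Rintegral _ _ _) /=.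
have dL := is_derive_laplace mD mf f0 pi_ge0 (ipi mOmega) k0.
apply: (@near_eq_is_derive _ _ _
    (((- f x) \*: id) + cst (ln (pi x)) - (@ln R \o L))).
  near=> t; have t0 : 0 < t by near: t; exact: lt_nbhsr.
  have -> : ln (m t x) = - f x * t + ln (pi x) - ln (L t).
    by rewrite ln_nmd ?ltW//; ring.
  by [].
have dlnL := is_derive_ln (L_gt0 k0') dL.
apply: is_derive_eq; rewrite addr0 /GRing.scale/= mulr1 mulrN opprK addrC.
by [].
Unshelve. all: by end_near. Qed.

Lemma right_derive_ln_nmd0 x :
  ((ln (m h x) - ln (m 0 x)) / h)%:E @[h --> 0^'+] -->
  (nmd_expectation Omega f pi 0 - (f x)%:E)%E.
Proof.
rewrite nmd_expectationE//.
have -> : (\int[leb]_(x in Omega) (f x * (expR (- 0 * f x) * pi x))%:E =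
           \int[leb]_(x in Omega) (f x * pi x)%:E)%E.
  by apply: eq_integral => y _; rewrite oppr0 mul0r expR0 mul1r.
have slope := cvg_ln_laplace_slope0 mD mf f0 pi_ge0 (ipi mOmega) L_gt0.
set l := (X in _ --> (X - _)%E).
have lim : (((ln (L 0) - ln (L h)) / h)%:E - (f x)%:E)%E @[h --> 0^'+] -->
    (l - (f x)%:E)%E.
  by apply: cvgeB; [exact: fin_num_adde_defl|exact: slope|exact: cvg_cst].
apply: cvg_trans lim; apply: near_eq_cvg; near=> h.
have h0 : 0 < h by near: h; exact: nbhs_right_gt.
have -> : ln (m h x) - ln (m 0 x) = (ln (L 0) - ln (L h)) - h * f x.
  by rewrite (ln_nmd _ (ltW h0)) (ln_nmd _ (lexx 0)); ring.
by rewrite -EFinB; congr EFin; field; rewrite gt_eqF.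
Unshelve. all: by end_near. Qed.

(** By [laplace_ge], m k x <= pi x / Pi(A) * exp(- (f x - c) k). *)
Lemma nmd_cvg0 x (c : R) (A : set V) : leb_measurable A -> A `<=` Omega ->
    (forall y, A y -> f y <= c) -> 0 < \int[leb]_(y in A) pi y -> c < f x ->
  m k x @[k --> +oo] --> 0.
Proof.
move=> mA AO fc A_gt0 cx; set a := \int[leb]_(y in A) pi y in A_gt0.
have dom k : 0 < k -> 0 <= m k x <= pi x / a * expR (- ((f x - c) * k)).
  move=> k0; have k0' := ltW k0; rewrite (ltW (m_gt0 _ k0'))/=.
  rewrite ler_pdivrMr ?L_gt0//.
  have La := laplace_ge mD mf f0 pi_ge0 (ipi mOmega) mA AO k0' fc.
  apply: le_trans (ler_wpM2l _ La); last by rewrite mulr_ge0 ?divr_ge0 ?expR_ge0// ltW.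
  rewrite -/a.
  have -> : - k * f x = - ((f x - c) * k) + - k * c by ring.
  rewrite expRD le_eqVlt; apply/orP; left; apply/eqP; field.
  by rewrite gt_eqF.
apply: (squeeze_cvgr (f := cst 0) (h := fun k => pi x / a * expR (- ((f x - c) * k)))).
- by near=> k; apply: dom; near: k; exact: nbhs_pinfty_gt.
- exact: cvg_cst.
rewrite -[X in _ --> X](mulr0 (pi x / a)); apply: cvgMl_tmp.
have fxc : 0 < f x - c by rewrite subr_gt0.
exact: cvg_comp (gt0_cvgMry fxc cvg_id) (@cvgr_expR R).
Unshelve. all: by end_near. Qed.

Let mminima : leb_measurable (minima Omega f).
Proof. exact: (mf mD (measurable_set1 0)). Qed.

(** By continuity f < f x / 2 on Omega near x0, and this part of Omega has
positive mass because it is not null and pi > 0. *)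
Lemma nmd_cvg0_locally_nonnull x x0 : Omega x -> ~ minima Omega f x ->
  minima Omega f x0 -> locally_nonnull Omega x0 -> m k x @[k --> +oo] --> 0.
Proof.
move=> Ox nx [Ox0 fx00] nonnull.
have fx : 0 < f x.
  by rewrite lt_neqAle f0// andbT; apply/eqP => fx; apply: nx; split.
have fx2 : 0 < f x / 2 by rewrite divr_gt0.
have /subspace_continuousP/(_ _ Ox0) cfx0 := cf.
have /nbhs_ballP[e /= e0 sub] : \forall y \near x0, Omega y -> f y < f x / 2.
  have fx0_lt : f x0 < f x / 2 by rewrite fx00.
  exact: (cvgr_lt _ cfx0 _ fx0_lt).
have mA : leb_measurable (Omega `&` ball x0 e).
  by apply: measurableI => //; apply: open_leb_measurable; exact: ball_open.
apply: (nmd_cvg0 mA (c := f x / 2)).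
- exact: subIsetl.
- by move=> y [Oy /sub/(_ Oy)/ltW].
- by apply: Rintegral_gt0 => //; [exact: ipi|exact: nonnull].
- by lra.
Qed.

Lemma nmd_cvg0_minima_gt0 x : Omega x -> ~ minima Omega f x ->
  0 < prob_mass pi (minima Omega f) -> m k x @[k --> +oo] --> 0.
Proof.
move=> Ox nx P_gt0.
apply: (nmd_cvg0 mminima (c := 0)) => //; first by move=> y [].
  by move=> y [_ ->].
by rewrite lt_neqAle f0// andbT; apply/eqP => fx; apply: nx; split.
Qed.

Let cvgL : L k @[k --> +oo] --> prob_mass pi (minima Omega f).
Proof. exact: (cvg_laplace_pinfty mD mf f0 pi_ge0 (ipi mOmega)). Qed.

Lemma nmd_minimaE (k : R) x : minima Omega f x -> m k x = pi x * (L k)^-1.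
Proof. by move=> [_ fx]; rewrite /nmd fx mulr0 expR0 mul1r. Qed.

Lemma nmd_cvgy x : minima Omega f x -> prob_mass pi (minima Omega f) = 0 ->
  m k x @[k --> +oo] --> +oo.
Proof.
move=> xm P0; have := cvgL; rewrite P0 => L_cvg0.
under eq_fun do rewrite (nmd_minimaE _ xm).
apply: gt0_cvgMry => //; apply/cvgrVy => //.
by near=> k; rewrite L_gt0//; near: k; exact: nbhs_pinfty_ge.
Unshelve. all: by end_near. Qed.

Lemma nmd_cvg_minima x : minima Omega f x -> 0 < prob_mass pi (minima Omega f) ->
  m k x @[k --> +oo] --> pi x / prob_mass pi (minima Omega f).
Proof.
move=> xm P_gt0; under eq_fun do rewrite (nmd_minimaE _ xm).
by apply: cvgMl_tmp; apply: cvgV => //; rewrite gt_eqF.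
Qed.

(** The normalization cancels, so that maximizing m k amounts to maximizing the
log-density up to a constant. *)
Lemma maximizer_ln_le (k : R) x y : 0 <= k -> nmd_maximizers Omega f pi k x ->
  Omega y -> - k * f y + ln (pi y) <= - k * f x + ln (pi x).
Proof.
move=> k0 [_ max_x] /max_x; rewrite -ler_ln ?posrE ?m_gt0// !ln_nmd//.
by rewrite lerD2r.
Qed.

Lemma maximizer_f_le (B k : R) x y : (forall x, pi x <= B) -> 0 < k ->
  nmd_maximizers Omega f pi k x -> minima Omega f y ->
  0 <= f x <= (ln B - ln (pi y)) / k.
Proof.
move=> piB k0 max_x [Oy fy]; rewrite f0/=; last by have [] := max_x.
have := maximizer_ln_le (ltW k0) max_x Oy; rewrite fy mulr0 add0r => le_x.
have : ln (pi x) <= ln B by rewrite ler_ln ?posrE// (lt_le_trans (pi_gt0 x)).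
by rewrite ler_pdivlMr//; lra.
Qed.

Lemma maximizer_pi_ge (k : R) x y : 0 <= k -> nmd_maximizers Omega f pi k x ->
  minima Omega f y -> pi y <= pi x.
Proof.
move=> k0 max_x [Oy fy]; rewrite -ler_ln ?posrE//.
have := maximizer_ln_le k0 max_x Oy; rewrite fy mulr0 add0r => /le_trans; apply.
by rewrite gerDr mulNr oppr_le0 mulr_ge0 ?f0//; have [] := max_x.
Qed.

(** Each point is optimal for its own parameter.  Adding the two inequalities
gives (k - j) (f y - f x) <= 0, hence f y <= f x, and then the optimality of x
for j gives ln (pi y) <= ln (pi x) + j (f y - f x).  Strictness of j < k matters:
one m k can have several maximizers, with different values of pi. *)
Lemma maximizer_pi_le (j k : R) x y : 0 <= j -> j < k ->
  nmd_maximizers Omega f pi j x -> nmd_maximizers Omega f pi k y -> pi y <= pi x.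
Proof.
move=> j0 jk max_x max_y.
have k0 := le_trans j0 (ltW jk).
have xy := maximizer_ln_le j0 max_x (proj1 max_y).
have yx := maximizer_ln_le k0 max_y (proj1 max_x).
rewrite -ler_ln ?posrE//.
have fyx : f y <= f x by rewrite -(ler_pM2l (x := k - j)) ?subr_gt0//; lra.
have : j * f y <= j * f x by rewrite ler_wpM2l.
lra.
Qed.

(** Stated along an arbitrary filter, so as to cover families of maximizers
indexed by the positive reals and sequences indexed by the integers. *)
Lemma maximizer_f_cvg0 (T : Type) (F : set_system T) (FF : Filter F) (k_ : T -> R)
    (xs : T -> V) B : (forall x, pi x <= B) -> minima Omega f !=set0 ->
    k_ t @[t --> F] --> +oo ->
    (forall t, 0 < k_ t -> nmd_maximizers Omega f pi (k_ t) (xs t)) ->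
  f (xs t) @[t --> F] --> 0.
Proof.
move=> piB [y miny] koo max_xs.
have k_gt0 : \forall t \near F, 0 < k_ t by move/cvgryPgt : koo; exact.
apply: (squeeze_cvgr (f := cst 0) (h := fun t => (ln B - ln (pi y)) * (k_ t)^-1)).
- near=> t; have kt : 0 < k_ t by near: t.
  exact: (maximizer_f_le piB kt (max_xs t kt) miny).
- exact: cvg_cst.
rewrite -[X in _ --> X](mulr0 (ln B - ln (pi y))); apply: cvgMl_tmp.
exact/gtr0_cvgV0.
Unshelve. all: by end_near. Qed.

Lemma maximizer_pi_ge_sup (k : R) x : minima Omega f !=set0 -> 0 <= k ->
  nmd_maximizers Omega f pi k x -> sup [set pi x | x in minima Omega f] <= pi x.
Proof.
move=> [y0 min0] k0 max_x; apply: ge_sup; first by exists (pi y0), y0.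
by move=> _ [y miny <-]; exact: (maximizer_pi_ge k0).
Qed.

Lemma maximizer_pi_nonincreasing (xs : nat -> V) :
    (forall n, nmd_maximizers Omega f pi n.+1%:R (xs n)) ->
  nonincreasing_seq (fun n => pi (xs n)).
Proof.
move=> max_xs i j; rewrite leq_eqVlt => /predU1P[->//|ij].
by apply: (maximizer_pi_le _ _ (max_xs i) (max_xs j)); rewrite ?ltr_nat.
Qed.

Lemma maximizer_pi_cvg (xs : nat -> V) :
    (forall n, nmd_maximizers Omega f pi n.+1%:R (xs n)) ->
  pi (xs n) @[n --> \oo] --> limn_inf (fun n => pi (xs n)).
Proof.
move=> max_xs; have cpi : cvgn (fun n => pi (xs n)).
  apply: nonincreasing_is_cvgn; first exact: maximizer_pi_nonincreasing.
  by exists 0 => _ [n _ <-].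
by rewrite cvg_limn_infE.
Qed.

End nascent_minima.

Theorem theorem4 (R : realType) (d : nat) (Omega : set 'rV[R]_d)
    (f pi : 'rV[R]_d -> R) :
  leb_measurable Omega ->
  {within Omega, continuous f} ->
  (forall x, Omega x -> 0 <= f x) ->
  minima Omega f !=set0 ->
  is_pdf setT pi ->
  (forall x, 0 < pi x) ->
  (forall k, 0 <= k -> (0 < nmd_denom Omega f pi k < +oo)%E) ->
  let m := nmd Omega f pi in
  let Pi := prob_mass pi in
  let Omegastar := minima Omega f in
  let pistar := sup [set pi x | x in Omegastar] in
  (* (1) *)
  ((forall k, 0 <= k -> is_pdf Omega (m k)) /\
   (forall x, Omega x -> m 0 x = pi x / Pi Omega)) /\
  (* (2) *)
  (continuous_gradient pi -> continuous_gradient f ->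
   forall k x, 0 <= k -> Omega x ->
     has_gradient (fun y => ln (m k y)) x /\
     gradient (fun y => ln (m k y)) x =
       - k *: gradient f x + (pi x)^-1 *: gradient pi x) /\
  (* (3) *)
  (forall x, Omega x ->
     (forall k, 0 < k ->
        nmd_expectation Omega f pi k \is a fin_num /\
        is_derive k 1 (fun t => ln (m t x))
          (fine (nmd_expectation Omega f pi k) - f x)) /\
     ((ln (m h x) - ln (m 0 x)) / h)%:E @[h --> 0^'+] -->
       (nmd_expectation Omega f pi 0 - (f x)%:E)%E) /\
  (* (4) *)
  (forall x, Omega x ->
     (Pi Omegastar = 0 ->
        (~ Omegastar x ->
         (exists2 x0, Omegastar x0 & locally_nonnull Omega x0) ->
         m k x @[k --> +oo] --> 0) /\
        (Omegastar x -> m k x @[k --> +oo] --> +oo)) /\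
     (0 < Pi Omegastar ->
        (~ Omegastar x -> m k x @[k --> +oo] --> 0) /\
        (Omegastar x -> m k x @[k --> +oo] --> pi x / Pi Omegastar))) /\
  (* (5) *)
  ((exists B, forall x, pi x <= B) ->
   (forall xs : R -> 'rV[R]_d,
      (forall k, 0 < k -> nmd_maximizers Omega f pi k (xs k)) ->
      let pis := fun n : nat => pi (xs n.+1%:R) in
      [/\ f (xs k) @[k --> +oo] --> 0,
          forall k, 0 < k -> pistar <= pi (xs k),
          nonincreasing_seq pis &
          pis n @[n --> \oo] --> limn_inf pis]) /\
   (forall xs : nat -> 'rV[R]_d,
      (forall n, (0 < n)%N -> nmd_maximizers Omega f pi n%:R (xs n)) ->
      let pis := fun n : nat => pi (xs n.+1) in
      [/\ f (xs n) @[n --> \oo] --> 0,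
          forall n, (0 < n)%N -> pistar <= pi (xs n),
          nonincreasing_seq pis &
          pis n @[n --> \oo] --> limn_inf pis])).
Proof.
move=> mO cf f0 min_neq0 pdf_pi pi_gt0 denom_gt0 m Pi Omegastar pistar.
split; last split; last split; last split.
- split=> [k|x _]; first exact: nmd_is_pdf.
  exact: nmd0.
- by move=> dpi df k x k0 _; exact: gradient_ln_nmd.
- move=> x Ox; split=> [k k0|]; first exact: is_derive_ln_nmd.
  exact: right_derive_ln_nmd0.
- move=> x Ox; split=> [P0|P_gt0]; split.
  + by move=> nx [x0 min_x0 nonnull]; exact: nmd_cvg0_locally_nonnull nonnull.
  + by move=> minx; exact: nmd_cvgy.
  + by move=> nx; exact: nmd_cvg0_minima_gt0.
  + by move=> minx; exact: nmd_cvg_minima.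
move=> [B piB]; split=> xs max_xs pis.
- have max_pis n : nmd_maximizers Omega f pi n.+1%:R (xs n.+1%:R).
    by apply: max_xs; rewrite ltr0n.
  split.
  + exact: (maximizer_f_cvg0 f0 pi_gt0 denom_gt0 _ piB min_neq0 cvg_id max_xs).
  + move=> k k0.
    exact: (maximizer_pi_ge_sup f0 pi_gt0 denom_gt0 min_neq0 (ltW k0) (max_xs k k0)).
  + exact: maximizer_pi_nonincreasing max_pis.
  + exact: maximizer_pi_cvg max_pis.
- have max_pis n : nmd_maximizers Omega f pi n.+1%:R (xs n.+1) by exact: max_xs.
  split.
  + apply: (maximizer_f_cvg0 f0 pi_gt0 denom_gt0 _ piB min_neq0 cvgr_idn).
    by move=> n; rewrite ltr0n; exact: max_xs.
  + move=> n n0; apply: (maximizer_pi_ge_sup f0 pi_gt0 denom_gt0 min_neq0 (ler0n _ n)).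
    exact: max_xs.
  + exact: maximizer_pi_nonincreasing max_pis.
  + exact: maximizer_pi_cvg max_pis.
Qed.
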